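(* Let $G$ be a countable abelian torsion group. Then $G$ is a strongly (D)CI$_f$-group if and only if every finite subgroup of $G$ is a (D)CI-group.
   Context: For a group $G$ and a subset $S\subseteq G\setminus\{e\}$, the Cayley digraph $\mathrm{Cay}(G;S)$ has vertex set $G$ and an arc from $g$ to $gs$ for all $g\in G$, $s\in S$; if $S=S^{-1}$ it is regarded as an undirected Cayley graph. The digraph $\mathrm{Cay}(G;S)$ is a DCI-graph if whenever $S'\subseteq G\setminus\{e\}$ and $\mathrm{Cay}(G;S)\cong\mathrm{Cay}(G;S')$ as digraphs, there is a group automorphism $\alpha$ of $G$ with $\alpha(S)=S'$. An undirected Cayley graph (so $S=S^{-1}$) is a CI-graph if the same holds for all $S'=S'^{-1}$. A group is a (D)CI-group if every Cayley (di)graph on it is a (D)CI-graph. A group is a strongly (D)CI$_f$-group if every locally finite Cayley (di)graph $\mathrm{Cay}(G;S)$ on it (i.e. $S$ finite, not necessarily generating) is a (D)CI-graph. The notation ''(D)CI'' means that the statement holds in two versions: for undirected graphs with ''CI'' throughout, and for digraphs with ''DCI'' throughout. *)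

(* Defs.v *)
From HB Require Import structures.
From mathcomp Require Import all_boot all_order all_algebra.
From mathcomp Require Import boolp classical_sets functions cardinality.

Set Implicit Arguments.
Unset Strict Implicit.
Unset Printing Implicit Defensive.

Import GRing.Theory.
Local Open Scope classical_set_scope.
Local Open Scope ring_scope.

(* A digraph on V is its arc relation; an undirected graph is a digraph whose
   arc relation is symmetric, so the same isomorphisms serve for both. *)
Definition digraph (V : Type) := V -> V -> Prop.

Definition digraph_iso (V W : Type) (E : digraph V) (F : digraph W) : Prop :=
  exists f : V -> W, bijective f /\ forall x y, E x y <-> F (f x) (f y).

Section Cayley.
(* Abelian groups, written additively: the arcs of Cay(G; S) are the pairs
   (g, g + s), and the condition that S avoids the identity is ~ S 0. *)
Variable G : zmodType.
Implicit Types S : set G.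

Definition Cay S : digraph G := fun g h => exists2 s, S s & h = g + s.

Definition inv_closed S : Prop := [set - s | s in S] = S.

Definition aut_equivalent S S' : Prop :=
  exists alpha : {additive G -> G}, bijective alpha /\ alpha @` S = S'.

Definition DCI_graph S : Prop :=
  forall S', ~ S' 0 -> digraph_iso (Cay S) (Cay S') -> aut_equivalent S S'.

Definition CI_graph S : Prop :=
  forall S', ~ S' 0 -> inv_closed S' -> digraph_iso (Cay S) (Cay S') ->
    aut_equivalent S S'.

Definition DCI_group : Prop := forall S, ~ S 0 -> DCI_graph S.

Definition CI_group : Prop := forall S, ~ S 0 -> inv_closed S -> CI_graph S.

(* Cay(G; S) is locally finite exactly when S is finite; S need not
   generate G. *)
Definition strongly_DCIf_group : Prop :=
  forall S, ~ S 0 -> finite_set S -> DCI_graph S.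

Definition strongly_CIf_group : Prop :=
  forall S, ~ S 0 -> inv_closed S -> finite_set S -> CI_graph S.

Definition torsion_group : Prop :=
  forall x : G, exists n : nat, (0 < n)%N /\ x *+ n = 0.

End Cayley.

Arguments DCI_group : clear implicits.
Arguments CI_group : clear implicits.
Arguments strongly_DCIf_group : clear implicits.
Arguments strongly_CIf_group : clear implicits.
Arguments torsion_group : clear implicits.

(* A subgroup H of G viewed as an abelian group in its own right, with the
   operations inherited from G. *)
Record subgroup_type (G : zmodType) (H : zmodClosed G) := SubgroupElt {
  subgroup_val : G;
  subgroup_valP : subgroup_val \in H
}.

HB.instance Definition _ (G : zmodType) (H : zmodClosed G) :=
  [isSub for @subgroup_val G H].
HB.instance Definition _ (G : zmodType) (H : zmodClosed G) :=
  [Choice of subgroup_type H by <:].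
HB.instance Definition _ (G : zmodType) (H : zmodClosed G) :=
  [SubChoice_isSubZmodule of subgroup_type H by <:].

(* Main.v *)
Require Import Defs.
From HB Require Import structures.
From mathcomp Require Import all_boot all_order all_algebra.
From mathcomp Require Import boolp classical_sets functions cardinality.

Set Implicit Arguments.
Unset Strict Implicit.
Unset Printing Implicit Defensive.

Import GRing.Theory.
Local Open Scope classical_set_scope.
Local Open Scope ring_scope.

(** Why the theorem holds.  The directed and the undirected version have the
    same proof, so everything is done for [CI_class u], where the boolean [u]
    says whether connection sets are required to be closed under negation.

    From G to a finite subgroup H ([CI_class_subgroup]).  An isomorphism
    between Cayley graphs of H can be repeated on every coset of H, so the two
    connection sets are also exchanged by an automorphism alpha of G.  It
    restricts to H as soon as it sends H into H.  If it does not, then the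
    elements of H that alpha keeps in H form a proper subgroup containing S, so
    the complement of S in H contains the complement of a proper subgroup and
    generates H.  Complementary graphs being isomorphic too, the same argument
    applied to the complements now gives an automorphism of G that preserves H.

    From the finite subgroups to G ([CI_class_of_finite_subgroups]).  Let f be
    an isomorphism from Cay(G; S) to Cay(G; S') fixing 0.  It maps the component
    <S> onto the component <S'>.  Let A be a finite subgroup containing S and
    S'.  The subgroups <S> and <S'> have equally many cosets in A, so Cay(A; S)
    and Cay(A; S') are isomorphic and an automorphism beta of A maps S onto S'
    ([fusion]).  It remains to extend beta to G, and for this G is shown to be
    homogeneous: every isomorphism between two finite subgroups extends to an
    automorphism of G.  As G is countable and torsion, back and forth reduces
    this to adding to the domain one element x with p x already in the domain,
    p prime ([extend_prime]).  Let b be the image of p x; a root y of p y = b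
    outside the range is needed.  There are two cases.
    - If p x = p a' for some a' in the domain, then up to translation p x = 0,
      and the range cannot contain all elements killed by p unless the domain
      does, by counting ([torsion_outside_range]).
    - Otherwise b has no p-th root in the range at all, and any p-th root of b
      in G will do.  One exists because p x and b have the same order: the
      Cayley graphs of {a, -a} and {b, -b}, for a and b of the same order, are
      unions of isomorphic cycles, so inside a finite subgroup an
      automorphism takes a to b or -b ([same_order_divisible]). *)

(** * Subgroups, spans and finite subgroups of torsion groups *)

Lemma inj_surj_bijective (T U : Type) (f : T -> U) :
  injective f -> (forall y, exists x, f x = y) -> bijective f.
Proof.
move=> finj /choice[g fg]; exists g => // x.
exact/finj/fg.
Qed.

Lemma finite_inj_surj (T : eqType) (A : set T) (f : T -> T) :
  finite_set A -> (forall x, A x -> A (f x)) ->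
  (forall x y, A x -> A y -> f x = f y -> x = y) ->
  forall y, A y -> exists2 x, A x & f x = y.
Proof.
move=> /finite_seqP[s As] fA finj y Ay; rewrite As /= in fA finj Ay *.
have fs_sub : {subset map f (undup s) <= undup s}.
  by move=> _ /mapP[x + ->]; rewrite !mem_undup => /fA.
have fs_uniq : uniq (map f (undup s)).
  rewrite map_inj_in_uniq ?undup_uniq// => x z.
  by rewrite !mem_undup; exact: finj.
have [|_ fsE] := uniq_min_size fs_uniq fs_sub; first by rewrite size_map.
have := fsE y; rewrite mem_undup Ay => /mapP[x + ->].
by rewrite mem_undup; exists x.
Qed.

Lemma digraph_iso_sym (V W : Type) (E : digraph V) (F : digraph W) :
  digraph_iso E F -> digraph_iso F E.
Proof.
move=> [f [[g fK gK] fE]]; exists g; split; first by exists f.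
by move=> x y; rewrite fE !gK.
Qed.

Lemma CayE (G : zmodType) (S : set G) x y : Cay S x y <-> S (y - x).
Proof.
split=> [[s Ss ->]|Sxy]; first by rewrite addrAC subrr add0r.
by exists (y - x) => //; rewrite addrC subrK.
Qed.

Definition subgroup (G : zmodType) (A : set G) :=
  A 0 /\ forall x y, A x -> A y -> A (x - y).

Section SubgroupTheory.
Variables (G : zmodType) (A : set G) (sA : subgroup A).

Lemma subgroup0 : A 0. Proof. exact: sA.1. Qed.

Lemma subgroupB x y : A x -> A y -> A (x - y). Proof. exact: sA.2. Qed.

Lemma subgroupN x : A x -> A (- x).
Proof. by rewrite -sub0r; apply: subgroupB; exact: subgroup0. Qed.

Lemma subgroupD x y : A x -> A y -> A (x + y).
Proof. by move=> Ax Ay; rewrite -[y]opprK; apply/subgroupB/subgroupN. Qed.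

Lemma subgroupMn x n : A x -> A (x *+ n).
Proof.
move=> Ax; elim: n => [|n IHn]; first by rewrite mulr0n; exact: subgroup0.
by rewrite mulrS; apply: subgroupD.
Qed.

Lemma subgroupDr x y : A y -> A (x + y) <-> A x.
Proof.
move=> Ay; split=> [Axy|Ax]; last exact: subgroupD.
by rewrite -(addrK y x); exact: subgroupB.
Qed.

Lemma subgroupBC x y : A (x - y) -> A (y - x).
Proof. by move=> Axy; rewrite -opprB; exact: subgroupN. Qed.

Lemma subgroup_trans y x z : A (x - y) -> A (y - z) -> A (x - z).
Proof. by move=> Axy /(subgroupD Axy); rewrite addrA subrK. Qed.

End SubgroupTheory.

(** Subgroups are handled as classical sets, since those met below are given by
    existential conditions; this is the passage to the boolean subgroups over
    which the theorem quantifies. *)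
Lemma subgroup_zmodClosed (G : zmodType) (A : set G) :
  subgroup A -> exists H : zmodClosed G, forall x, x \in H <-> A x.
Proof.
move=> sA; have A_closed : GRing.zmod_closed (fun x : G => `[< A x >]).
  split=> [|x y /asboolP Ax /asboolP Ay]; apply/asboolP.
    exact: subgroup0.
  exact: subgroupB.
pose m := GRing.isZmodClosed.Build G (fun x => `[< A x >]) A_closed.
pose H : zmodClosed G := HB.pack (fun x : G => `[< A x >]) m.
by exists H => x; split=> /asboolP.
Qed.

Definition span (G : zmodType) (S : set G) : set G :=
  [set x | forall A, subgroup A -> S `<=` A -> A x].

Lemma span_subgroup (G : zmodType) (S : set G) : subgroup (span S).
Proof.
split=> [A sA _|x y Sx Sy A sA SA]; first exact: subgroup0.
by apply: subgroupB => //; [exact: Sx | exact: Sy].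
Qed.

Lemma sub_span (G : zmodType) (S : set G) : S `<=` span S.
Proof. by move=> x Sx A _; exact. Qed.

(** Along an arc the value of f moves by an element of S', and the x along which
    every translation moves f by an element of the span of S' form a subgroup;
    this replaces an induction on paths. *)
Lemma arc_map_span (G : zmodType) (S S' : set G) (f : G -> G) : f 0 = 0 ->
    (forall x y, Cay S x y -> Cay S' (f x) (f y)) ->
  forall x, span S x -> span S' (f x).
Proof.
move=> f0 f_arc x Sx; have sS' := span_subgroup S'.
pose A := [set z | forall y, span S' (f (z + y) - f y)].
suff : A x by move=> /(_ 0); rewrite f0 subr0 addr0.
apply: Sx.
  split=> [y|z w Az Aw y]; first by rewrite add0r subrr; exact: subgroup0.
  rewrite -addrA [- w + y]addrC.
  apply: subgroup_trans (Az (y - w)) _ => //.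
  by apply: (subgroupBC sS'); have := Aw (y - w); rewrite [w + _]addrC subrK.
move=> s Ss y; apply: sub_span; apply/CayE; apply: f_arc.
by apply/CayE; rewrite addrK.
Qed.

(** Natural multiples of x suffice to generate because x will have finite
    order. *)
Definition adjoin (G : zmodType) (A : set G) (x : G) : set G :=
  [set y | exists2 a, A a & exists n, y = a + x *+ n].

Section Adjoin.
Variables (G : zmodType) (A : set G) (x : G) (N : nat).
Hypotheses (sA : subgroup A) (N_gt0 : (0 < N)%N) (xN : x *+ N = 0).

Lemma sub_adjoin : A `<=` adjoin A x.
Proof. by move=> a Aa; exists a => //; exists 0; rewrite mulr0n addr0. Qed.

Lemma mem_adjoin : adjoin A x x.
Proof. by exists 0; [exact: subgroup0 | exists 1; rewrite add0r]. Qed.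

Lemma adjoin_subgroup : subgroup (adjoin A x).
Proof.
split; first by apply: sub_adjoin; exact: subgroup0.
move=> _ _ [a Aa [m ->]] [b Ab [n ->]]; exists (a - b); first exact: subgroupB.
(* - n is congruent to n * (N - 1) modulo the order N *)
exists (m + n * N.-1)%N; rewrite opprD addrACA mulrnDr; congr (_ + (_ + _)).
apply/eqP; rewrite eq_sym -addr_eq0 -mulrnDr -mulnSr prednK// mulnC mulrnA.
by rewrite xN mul0rn.
Qed.

Lemma adjoin_finite : finite_set A -> finite_set (adjoin A x).
Proof.
move=> finA; have := finite_image2 (fun a n => a + x *+ n) finA (finite_II N).
apply: sub_finite_set => _ [a Aa [n ->]]; exists a => //.
exists (n %% N)%N; first by rewrite /= ltn_mod.
by rewrite [in RHS](divn_eq n N) mulrnDr mulnC mulrnA xN mul0rn add0r.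
Qed.

End Adjoin.

Lemma torsion_finite_subgroup (G : zmodType) (S : set G) :
    torsion_group G -> finite_set S ->
  exists A : set G, [/\ subgroup A, finite_set A & S `<=` A].
Proof.
move=> Gtors /finite_seqP[s ->].
elim: s => [|x s [A [sA finA sub_sA]]].
  exists [set 0]; split; last by [].
    by split=> // x y -> ->; rewrite subr0.
  exact: finite_set1.
have [N [N_gt0 xN]] := Gtors x; exists (adjoin A x); split.
- exact: adjoin_subgroup xN.
- exact: adjoin_finite xN _.
- move=> y /=; rewrite inE => /predU1P[->|]; first exact: mem_adjoin.
  by move=> sy; apply: sub_adjoin; exact: sub_sA.
Qed.

(** * Gluing an isomorphism along cosets *)

Section Gluing.
Variable K : zmodType.
Implicit Types A B S : set K.

Definition coset_repr A (x : K) : K := xget 0 [set y | A (x - y)].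

Lemma coset_reprP A x : subgroup A -> A (x - coset_repr A x).
Proof.
move=> sA; rewrite /coset_repr; case: xgetP => [_ -> //|].
by move=> /(_ x) []; rewrite /= subrr; exact: subgroup0.
Qed.

Lemma coset_repr_eq A x y : subgroup A -> A (x - y) ->
  coset_repr A x = coset_repr A y.
Proof.
move=> sA Axy; rewrite /coset_repr; congr xget; apply/seteqP; split=> z /= Az.
  exact: (subgroup_trans sA (subgroupBC sA Axy) Az).
exact: (subgroup_trans sA Axy Az).
Qed.

Lemma coset_repr_sep A x y : subgroup A ->
  A (coset_repr A x - coset_repr A y) -> A (x - y).
Proof.
move=> sA Axy; apply: (subgroup_trans sA (coset_reprP x sA)).
exact: (subgroup_trans sA Axy (subgroupBC sA (coset_reprP y sA))).
Qed.

Definition transversal A : set K := range (coset_repr A).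

Lemma transversal_eq A t u : subgroup A -> transversal A t ->
  transversal A u -> A (t - u) -> t = u.
Proof.
move=> sA [x _ <-] [y _ <-] Axy; apply: coset_repr_eq => //.
exact: coset_repr_sep.
Qed.

Section GluedMap.
Variables (A B S S' : set K) (phi rho : K -> K).
Hypotheses (sA : subgroup A) (sB : subgroup B).
Hypotheses (SA : S `<=` A) (S'B : S' `<=` B).
Hypothesis phiB : forall x, A x -> B (phi x).
Hypothesis phi_inj : forall x y, A x -> A y -> phi x = phi y -> x = y.
Hypothesis phi_arc : forall x y, A x -> A y -> S (y - x) <-> S' (phi y - phi x).
Hypothesis rho_const : forall x y, A (x - y) -> rho x = rho y.
Hypothesis rho_sep : forall x y, B (rho x - rho y) -> A (x - y).

Definition glue x := rho x + phi (x - coset_repr A x).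

Let fiberA x : A (x - coset_repr A x). Proof. exact: coset_reprP. Qed.

Let glueB x y : A (x - y) ->
  glue x - glue y = phi (x - coset_repr A x) - phi (y - coset_repr A x).
Proof.
move=> Axy; rewrite /glue -(coset_repr_eq sA Axy) (rho_const Axy).
by rewrite opprD addrACA subrr add0r.
Qed.

Let fiberA2 x y : A (x - y) -> A (y - coset_repr A x).
Proof. by move=> Axy; rewrite (coset_repr_eq sA Axy). Qed.

Let glue_sep x y : B (glue x - glue y) -> A (x - y).
Proof.
move=> Bxy; apply: rho_sep.
have Bphi : B (phi (x - coset_repr A x) - phi (y - coset_repr A y)).
  by apply: (subgroupB sB); apply: phiB; exact: fiberA.
by move: Bxy; rewrite /glue opprD addrACA (subgroupDr sB _ Bphi).
Qed.

(** [glue] sends the coset x + A into the coset [rho x + B] and is a translate of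
    [phi] there; it is a graph isomorphism because all arcs stay inside cosets. *)
Lemma glue_inj : injective glue.
Proof.
move=> x y exy; have Axy : A (x - y).
  by apply: glue_sep; rewrite exy subrr; exact: subgroup0.
have := glueB Axy; rewrite exy subrr => /esym/subr0_eq/phi_inj.
by move=> /(_ (fiberA x) (fiberA2 Axy)) /subIr.
Qed.

Lemma glue_arc x y : Cay S x y <-> Cay S' (glue x) (glue y).
Proof.
rewrite !CayE; split=> [Sxy|S'xy].
  have Axy := SA Sxy; rewrite glueB// -phi_arc ?opprB ?addrA ?subrK//.
  exact: fiberA2.
have Axy := glue_sep (S'B S'xy); move: S'xy.
by rewrite glueB// -phi_arc ?opprB ?addrA ?subrK//; exact: fiberA2.
Qed.

Lemma glue_surj : (forall y, B y -> exists2 x, A x & phi x = y) ->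
  (forall y, exists x, B (y - rho x)) -> forall y, exists x, glue x = y.
Proof.
move=> phi_surj rho_surj y; have [x /phi_surj[a Aa phia]] := rho_surj y.
have Ax : A (coset_repr A x + a - x).
  rewrite addrAC (subgroupDr sA _ Aa).
  exact: (subgroupBC sA (coset_reprP x sA)).
exists (coset_repr A x + a); rewrite /glue (rho_const Ax).
by rewrite (coset_repr_eq sA Ax) addrAC subrr add0r phia addrC subrK.
Qed.

End GluedMap.

(** Infinitely many cosets are allowed here: both graphs live on the same
    subgroup, and every coset is mapped to itself. *)
Lemma Cay_iso_ambient A S S' (phi : K -> K) : subgroup A ->
    S `<=` A -> S' `<=` A ->
    (forall x, A x -> A (phi x)) ->
    (forall x y, A x -> A y -> phi x = phi y -> x = y) ->
    (forall y, A y -> exists2 x, A x & phi x = y) ->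
    (forall x y, A x -> A y -> S (y - x) <-> S' (phi y - phi x)) ->
  digraph_iso (Cay S) (Cay S').
Proof.
move=> sA SA S'A phiA phi_inj phi_surj phi_arc.
have repr_const x y : A (x - y) -> coset_repr A x = coset_repr A y.
  exact: coset_repr_eq.
have repr_sep x y : A (coset_repr A x - coset_repr A y) -> A (x - y).
  exact: coset_repr_sep.
exists (glue A phi (coset_repr A)); split; last first.
  exact: (glue_arc sA sA SA S'A phiA phi_arc repr_const repr_sep).
apply: inj_surj_bijective; first exact:
  (glue_inj sA sA phiA phi_inj repr_const repr_sep).
by apply: (glue_surj sA repr_const phi_surj) => y; exists y; exact: coset_reprP.
Qed.

(** Instead of computing the number of cosets, one compares the two transversals:
    an injection between them glues to an injective arc-preserving map of a
    finite group into itself, which is onto. *)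
Lemma Cay_iso_transversal_le A B S S' (phi : K -> K) :
    finite_set [set: K] -> subgroup A -> subgroup B ->
    S `<=` A -> S' `<=` B ->
    (forall x, A x -> B (phi x)) ->
    (forall x y, A x -> A y -> phi x = phi y -> x = y) ->
    (forall x y, A x -> A y -> S (y - x) <-> S' (phi y - phi x)) ->
    (transversal A #<= transversal B)%card ->
  digraph_iso (Cay S) (Cay S').
Proof.
move=> finK sA sB SA S'B phiB phi_inj phi_arc.
move=> /(@pcard_leP _ (HB.pack_for pointedType K (isPointed.Build K 0))).
case=> j.
have tA x : transversal A (coset_repr A x) by exists x.
pose rho x := j (coset_repr A x).
have rho_const x y : A (x - y) -> rho x = rho y.
  by move=> Axy; rewrite /rho (coset_repr_eq sA Axy).
have rho_sep x y : B (rho x - rho y) -> A (x - y).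
  move=> Bxy; have /inj : rho x = rho y.
    by apply: transversal_eq Bxy => //; exact: funS.
  rewrite !inE => /(_ (tA x) (tA y)) exy.
  by apply: coset_repr_sep => //; rewrite exy subrr; exact: subgroup0.
exists (glue A phi rho); split; last first.
  exact: (glue_arc sA sB SA S'B phiB phi_arc rho_const rho_sep).
have ginj := glue_inj sA sB phiB phi_inj rho_const rho_sep.
apply: inj_surj_bijective => // y.
have [//|x y' _ _|//|x _ <-] :=
  @finite_inj_surj K setT (glue A phi rho) finK _ _ y.
  exact: ginj.
by exists x.
Qed.

Lemma Cay_iso_finite A B S S' (phi : K -> K) :
    finite_set [set: K] -> subgroup A -> subgroup B ->
    S `<=` A -> S' `<=` B ->
    (forall x, A x -> B (phi x)) ->
    (forall x y, A x -> A y -> phi x = phi y -> x = y) ->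
    (forall y, B y -> exists2 x, A x & phi x = y) ->
    (forall x y, A x -> A y -> S (y - x) <-> S' (phi y - phi x)) ->
  digraph_iso (Cay S) (Cay S').
Proof.
move=> finK sA sB SA S'B phiB phi_inj phi_surj phi_arc.
have fin (X : set K) : finite_set X by apply: sub_finite_set finK.
have /finite_setP[m Am] := fin (transversal A).
have /finite_setP[n Bn] := fin (transversal B).
have [le_mn|/ltnW le_nm] := leqP m n.
  apply: (Cay_iso_transversal_le finK sA sB SA S'B phiB phi_inj phi_arc).
  by rewrite (card_le_eql Am) (card_le_eqr Bn) card_le_II.
have /choice[psi psiP] y : exists x, B y -> A x /\ phi x = y.
  have [By|NBy] := pselect (B y); last by exists 0.
  by have [x Ax xy] := phi_surj y By; exists x.
apply: digraph_iso_sym.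
apply: (Cay_iso_transversal_le (phi := psi) finK sB sA) => //.
- by move=> y /psiP[].
- by move=> x y /psiP[_ {2}<-] /psiP[_ {2}<-] ->.
- by move=> x y /psiP[Ax {1}<-] /psiP[Ay {1}<-]; rewrite -phi_arc.
- by rewrite (card_le_eql Bn) (card_le_eqr Am) card_le_II.
Qed.

End Gluing.

(** * From the group to its finite subgroups *)

(** With [undirected] false this is the directed version.  Finiteness of S costs
    nothing on a finite group, so the same predicate covers G and its finite
    subgroups. *)
Definition CI_class (undirected : bool) (G : zmodType) : Prop :=
  forall S S' : set G, ~ S 0 -> ~ S' 0 ->
    (undirected -> inv_closed S) -> (undirected -> inv_closed S') ->
    finite_set S -> digraph_iso (Cay S) (Cay S') -> aut_equivalent S S'.

Lemma strongly_DCIfE (G : zmodType) :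
  strongly_DCIf_group G <-> CI_class false G.
Proof.
split=> [ciG S S' S0 S'0 _ _ finS|ciG S S0 finS S' S'0]; first exact: ciG.
exact: ciG.
Qed.

Lemma strongly_CIfE (G : zmodType) : strongly_CIf_group G <-> CI_class true G.
Proof.
split=> [ciG S S' S0 S'0 iS iS' finS|ciG S S0 iS finS S' S'0 iS'].
  by apply: ciG; auto.
exact: ciG.
Qed.

Lemma DCI_finiteE (G : zmodType) : finite_set [set: G] ->
  DCI_group G <-> CI_class false G.
Proof.
move=> finG; split=> [ciG S S' S0 S'0 _ _ _|ciG S S0 S' S'0]; first exact: ciG.
by apply: ciG => //; exact: sub_finite_set finG.
Qed.

Lemma CI_finiteE (G : zmodType) : finite_set [set: G] ->
  CI_group G <-> CI_class true G.
Proof.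
move=> finG; split=> [ciG S S' S0 S'0 iS iS' _|ciG S S0 iS S' S'0 iS'].
  by apply: ciG; auto.
by apply: ciG => //; exact: sub_finite_set finG.
Qed.

Lemma inv_closedP (G : zmodType) (S : set G) :
  inv_closed S <-> (forall x, S x -> S (- x)).
Proof.
split=> [iS x Sx|iS]; first by rewrite -iS; exists x.
apply/seteqP; split=> [_ [x Sx <-]|x Sx]; first exact: iS.
by exists (- x); [exact: iS | rewrite opprK].
Qed.

Section InsideSubgroup.
Variables (G : zmodType) (H : zmodClosed G).
Local Notation K := (subgroup_type H).

Lemma subgroup_mem : subgroup [set x | x \in H].
Proof. by split=> [|x y xH yH]; [exact: rpred0 | exact: rpredB]. Qed.

Lemma subgroup_type_finite :
  finite_set [set x : G | x \in H] -> finite_set [set: K].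
Proof.
move=> finH; apply: sub_finite_set (finite_image (insubd (0 : K)) finH).
by move=> x _; exists (val x); [exact: valP | rewrite valKd].
Qed.

Lemma subgroup_insubdK (x : G) : x \in H -> val (insubd (0 : K) x) = x.
Proof. by move=> xH; rewrite insubdK. Qed.

Lemma subgroup_valB (x y : K) : val (x - y) = val x - val y.
Proof. exact: raddfB. Qed.

Lemma subgroup_val0 : val (0 : K) = 0. Proof. exact: raddf0. Qed.

Lemma val_image_mem (S : set K) (x : K) : (val @` S) (val x) <-> S x.
Proof. by split=> [[y Sy /val_inj <-]|Sx]; last exists x. Qed.

Lemma val_image_inv_closed (S : set K) : inv_closed S -> inv_closed (val @` S).
Proof.
move=> /inv_closedP iS; apply/inv_closedP => _ [x Sx <-].
by exists (- x); [exact: iS | exact: raddfN].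
Qed.

Lemma Cay_iso_val (S S' : set K) :
  digraph_iso (Cay S) (Cay S') -> digraph_iso (Cay (val @` S)) (Cay (val @` S')).
Proof.
move=> [f [[g fK gK] fE]].
apply: (@Cay_iso_ambient _ _ _ _ (fun x => val (f (insubd 0 x))) subgroup_mem).
- by move=> _ [x _ <-]; exact: valP.
- by move=> _ [x _ <-]; exact: valP.
- by move=> x _; exact: valP.
- move=> x y xH yH /val_inj/(can_inj fK) /(congr1 val).
  by rewrite !subgroup_insubdK.
- move=> y yH; exists (val (g (insubd 0 y))); first exact: valP.
  by rewrite valKd gK subgroup_insubdK.
- move=> x y xH yH.
  have -> : y - x = val (insubd (0 : K) y - insubd (0 : K) x).
    by rewrite subgroup_valB !subgroup_insubdK.
  rewrite -subgroup_valB.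
  by rewrite !val_image_mem -!CayE.
Qed.

(** By finiteness an injective alpha that sends H into itself restricts to an
    automorphism of H. *)
Lemma aut_equivalent_restrict (alpha : {additive G -> G}) (S S' : set K) :
    finite_set [set x : G | x \in H] -> injective alpha ->
    (forall x, x \in H -> alpha x \in H) ->
    (forall x : K, S x <-> (val @` S') (alpha (val x))) ->
  aut_equivalent S S'.
Proof.
move=> finH alpha_inj alphaH alphaS.
pose beta (x : K) : K := SubgroupElt (alphaH _ (valP x)).
have beta_add : GRing.zmod_morphism beta.
  move=> x y; apply: val_inj; rewrite subgroup_valB.
  by rewrite [LHS](congr1 alpha (subgroup_valB x y)) raddfB.
pose m := GRing.isZmodMorphism.Build K K beta beta_add.
pose b : {additive K -> K} := HB.pack beta m.
have b_inj : injective b.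
  by move=> x y /(congr1 val) /alpha_inj /val_inj.
have b_surj y : exists x, b x = y.
  have [//|x z _ _|//|x _ <-] :=
    @finite_inj_surj K setT b (subgroup_type_finite finH) _ _ y.
    exact: b_inj.
  by exists x.
have bS x : S x <-> S' (b x) by rewrite alphaS -val_image_mem.
exists b; split; first exact: inj_surj_bijective.
apply/seteqP; split=> [_ [x Sx <-]|y]; first exact/bS.
by have [x <-] := b_surj y; move=> /bS Sx; exists x.
Qed.

End InsideSubgroup.

(** Connection set of the complementary graph. *)
Definition co_connection (G : zmodType) (S : set G) : set G :=
  [set x | ~ S x /\ x <> 0].

Lemma co_connection_iso (G : zmodType) (S S' : set G) :
  digraph_iso (Cay S) (Cay S') ->
  digraph_iso (Cay (co_connection S)) (Cay (co_connection S')).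
Proof.
move=> [f [fbij fE]]; exists f; split=> // x y.
rewrite !CayE /co_connection /= -!CayE fE.
by split=> -[nS ne]; split=> // /subr0_eq; [move/(bij_inj fbij)|] => exy;
  apply: ne; rewrite exy subrr.
Qed.

Lemma co_connection_inv_closed (G : zmodType) (S : set G) :
  inv_closed S -> inv_closed (co_connection S).
Proof.
move=> /inv_closedP iS; apply/inv_closedP => x [nSx x0]; split.
  by move=> /iS; rewrite opprK.
by move=> /eqP; rewrite oppr_eq0 => /eqP.
Qed.

Lemma CI_class_subgroup u (G : zmodType) (H : zmodClosed G) :
  CI_class u G -> finite_set [set x : G | x \in H] ->
  CI_class u (subgroup_type H).
Proof.
set K := subgroup_type H.
move=> ciG finH S S' S0 S'0 iS iS' _ isoSS'.
have finK := subgroup_type_finite finH.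
have lift (T T' : set K) : ~ T 0 -> ~ T' 0 -> (u -> inv_closed T) ->
    (u -> inv_closed T') -> digraph_iso (Cay T) (Cay T') ->
    exists2 alpha : {additive G -> G}, injective alpha &
      forall x : K, T x <-> (val @` T') (alpha (val x)).
  move=> T0 T'0 iT iT' isoTT'.
  have [||uT|uT'||alpha [alpha_bij alphaT]] :=
    ciG (val @` T) (val @` T') _ _ _ _ _ (Cay_iso_val isoTT').
  - by rewrite -(subgroup_val0 H) val_image_mem.
  - by rewrite -(subgroup_val0 H) val_image_mem.
  - exact/val_image_inv_closed/iT.
  - exact/val_image_inv_closed/iT'.
  - by apply: finite_image; exact: sub_finite_set finK.
  exists alpha; first exact: bij_inj.
  move=> x; rewrite -alphaT; split=> [Tx|[_ [y Ty <-]]].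
    by exists (val x) => //; exists x.
  by move=> /(bij_inj alpha_bij)/val_inj <-.
have sH := subgroup_mem H.
have preserves (alpha : {additive G -> G}) (T T' : set K) :
    (forall x : K, T x <-> (val @` T') (alpha (val x))) ->
    forall x : K, T x -> alpha (val x) \in H.
  by move=> alphaT x /alphaT[y _ <-]; exact: valP.
have [alpha alpha_inj alphaS] := lift _ _ S0 S'0 iS iS' isoSS'.
have [alphaH|] := pselect (forall x, x \in H -> alpha x \in H).
  exact: aut_equivalent_restrict alphaH alphaS.
move=> /existsNP[x0 /not_implyP[x0H alphax0]].
have [||||alpha' alpha'_inj alpha'S] :=
  lift _ _ _ _ _ _ (co_connection_iso isoSS').
- by case.
- by case.
- by move=> /iS; exact: co_connection_inv_closed.
- by move=> /iS'; exact: co_connection_inv_closed.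
(* alpha maps S into H, so what it throws out of H lies in the complement *)
have out x : x \in H -> alpha x \notin H -> alpha' x \in H.
  move=> xH alphax; rewrite -(subgroup_insubdK xH).
  apply: (preserves _ _ _ alpha'S); split.
    move=> /(preserves _ _ _ alphaS); rewrite subgroup_insubdK//.
    exact/negP.
  move=> /(congr1 val); rewrite subgroup_insubdK// subgroup_val0 => x_0.
  by move: alphax; rewrite x_0 raddf0 rpred0.
(* an x kept in H by alpha is (x + x0) - x0, and alpha throws both terms out *)
have alpha'H x : x \in H -> alpha' x \in H.
  move=> xH; have [alphax|/negP alphax] := pselect (alpha x \in H); last first.
    exact: out.
  have: alpha' (x + x0) - alpha' x0 \in H.
    apply: rpredB; last by apply: out => //; exact/negP.
    apply: out; first exact: rpredD.
    by rewrite raddfD; rewrite rpredDl//; exact/negP.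
  by rewrite raddfD addrK.
apply: (aut_equivalent_restrict finH alpha'_inj alpha'H) => x.
have ax : alpha' (val x) \in H by exact/alpha'H/valP.
have := alpha'S x; rewrite -(subgroup_insubdK ax) !val_image_mem.
set y : subgroup_type H := insubd 0 _.
have x_0 : x = 0 <-> y = 0.
  split=> [x0E|/(congr1 val)].
    by apply: val_inj; rewrite subgroup_insubdK// x0E subgroup_val0 raddf0.
  rewrite subgroup_insubdK// subgroup_val0 -(raddf0 alpha') => /alpha'_inj.
  by rewrite -(subgroup_val0 H) => /val_inj.
rewrite /co_connection /= => coE.
have [xE0|xN0] := pselect (x = 0); first by rewrite (x_0.1 xE0) xE0.
have yN0 : y <> 0 by rewrite -x_0.
split=> [Sx|S'y]; apply: contrapT => nS.
  by have /coE[] : ~ S' y /\ y <> 0 by [].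
by have /coE[] : ~ S x /\ x <> 0 by [].
Qed.

(** * Finite partial automorphisms *)

Section PartialAutomorphisms.
Variable G : zmodType.
Implicit Types (P : set (G * G)) (x y : G).

(** Graph of an isomorphism between two finite subgroups of G.  Encoding it as a
    subgroup of G * G makes the inverse a transposition and makes adding a pair
    the adjunction of one element. *)
Definition partial_aut P : Prop :=
  [/\ subgroup P, finite_set P, forall y, P (0, y) -> y = 0 &
      forall x, P (x, 0) -> x = 0].

Definition converse P : set (G * G) := [set z | P (z.2, z.1)].

Definition dom P : set G := [set x | exists y, P (x, y)].

Lemma converse_partial_aut P : partial_aut P -> partial_aut (converse P).
Proof.
move=> [[P0 PB] finP Pfun Pinj]; split; rewrite /converse //=.
  by split=> // -[x1 x2] [y1 y2] /=; exact: PB.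
apply: (sub_finite_set _ (finite_image (fun z => (z.2, z.1)) finP)).
by move=> [x1 x2] /= Px; exists (x2, x1).
Qed.

Lemma dom_subgroup P : subgroup P -> subgroup (dom P).
Proof.
move=> [P0 PB]; split; first by exists 0.
by move=> x x' [y Pxy] [y' Pxy']; exists (y - y'); exact: PB Pxy Pxy'.
Qed.

Lemma pair_mulrn (x y : G) n : (x, y) *+ n = (x *+ n, y *+ n).
Proof. by elim: n => [|n IHn]; rewrite ?mulr0n // !mulrS IHn. Qed.

Lemma partial_autMn P x y n :
  subgroup P -> P (x, y) -> P (x *+ n, y *+ n).
Proof. by move=> sP /(subgroupMn sP n); rewrite pair_mulrn. Qed.

Lemma partial_aut_fun P x y y' :
  partial_aut P -> P (x, y) -> P (x, y') -> y = y'.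
Proof.
move=> [[_ PB] _ Pfun _] Pxy Pxy'; apply: subr0_eq; apply: Pfun.
by have := PB _ _ Pxy Pxy'; rewrite -(subrr x).
Qed.

Lemma partial_aut_inj P x x' y :
  partial_aut P -> P (x, y) -> P (x', y) -> x = x'.
Proof. by move=> /converse_partial_aut pP; exact: (partial_aut_fun pP). Qed.

(** Otherwise the inverse of P would embed the finite set of all elements
    killed by p into itself, hence onto itself, and x would be in the domain. *)
Lemma torsion_outside_range P x p : partial_aut P -> x *+ p = 0 -> ~ dom P x ->
  exists y, y *+ p = 0 /\ ~ dom (converse P) y.
Proof.
move=> pP xp nPx; have [sP finP Pfun Pinj] := pP.
apply: contrapT => /forallNP noy; apply: nPx.
have /choice[g gP] y : exists x, y *+ p = 0 -> P (x, y).
  have [yp|] := pselect (y *+ p = 0); last by exists 0.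
  have /not_andP[//|/contrapT[x' Px'y]] := noy y.
  by exists x'.
pose T := [set y : G | y *+ p = 0].
have finT : finite_set T.
  apply: (sub_finite_set _ (finite_image snd finP)) => y yp.
  by exists (g y, y) => //; exact: gP.
have [|y z yp zp|y yp <-] := finite_inj_surj (f := g) finT _ _ xp.
- move=> y yp; apply: Pinj; rewrite -[X in P (_, X)]yp.
  by apply: partial_autMn => //; exact: gP.
- move=> eg; apply: (partial_aut_fun pP (gP y yp)).
  by rewrite eg; exact: gP.
- by exists y; exact: gP.
Qed.

(** If n x is in the domain then p divides n, since otherwise x itself would be in
    the domain; so the new pair creates no relation beyond the one holding for
    (p x, p y). *)
Lemma adjoin_functional P x y p : subgroup P -> (forall y, P (0, y) -> y = 0) ->
    prime p -> P (x *+ p, y *+ p) -> ~ dom P x ->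
  forall z, adjoin P (x, y) (0, z) -> z = 0.
Proof.
move=> sP Pfun p_prime Pp nPx z [[a c] Pac [n]].
rewrite pair_mulrn; case=> e0 ->; have [p_n|p_n] := boolP (p %| n)%N.
  apply: Pfun; move: e0; rewrite -(divnK p_n) mulnC !mulrnA => e0.
  have : P (a + x *+ p *+ (n %/ p), c + y *+ p *+ (n %/ p)).
    exact: (subgroupD sP Pac (partial_autMn (n %/ p) sP Pp)).
  by rewrite -e0.
case: nPx; have sD := dom_subgroup sP.
have Dxp : dom P (x *+ p) by exists (y *+ p).
have Dxn : dom P (x *+ n).
  have -> : x *+ n = - a by apply/eqP; rewrite -addr_eq0 addrC -e0.
  by apply: (subgroupN sD); exists c.
have n_gt0 : (0 < n)%N by case: n p_n {e0 Dxn} => //; rewrite dvdn0.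
have [k l + _] := egcdnP p n_gt0.
have -> : gcdn n p = 1%N.
  by apply/eqP; rewrite -/(coprime n p) coprime_sym prime_coprime.
move=> kn; have -> : x = x *+ n *+ k - x *+ p *+ l.
  rewrite -!mulrnA [(n * k)%N]mulnC kn [(p * l)%N]mulnC mulrnDr mulr1n.
  by rewrite addrAC subrr add0r.
by apply: (subgroupB sD); exact: (subgroupMn sD).
Qed.

End PartialAutomorphisms.

(** * From the finite subgroups to the group *)

Section CIonSubgroups.
Variables (u : bool) (G : zmodType).
Implicit Type P : set (G * G).
Hypothesis Gtors : torsion_group G.
Hypothesis ciG : forall H : zmodClosed G, finite_set [set x : G | x \in H] ->
  CI_class u (subgroup_type H).

(** The CI property of the finite subgroup A, restated in G.  An isomorphism of
    the graphs is only asked for between subgroups B and C of A, which have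
    equally many cosets in A. *)
Lemma fusion (A B C S S' : set G) (phi : G -> G) :
    subgroup A -> finite_set A ->
    subgroup B -> B `<=` A -> subgroup C -> C `<=` A ->
    S `<=` B -> S' `<=` C -> ~ S 0 -> ~ S' 0 ->
    (u -> inv_closed S) -> (u -> inv_closed S') ->
    (forall x, B x -> C (phi x)) ->
    (forall x y, B x -> B y -> phi x = phi y -> x = y) ->
    (forall y, C y -> exists2 x, B x & phi x = y) ->
    (forall x y, B x -> B y -> S (y - x) <-> S' (phi y - phi x)) ->
  exists beta : G -> G, [/\ forall x, A x -> A (beta x),
    forall x y, A x -> A y -> beta (x - y) = beta x - beta y,
    forall x, A x -> beta x = 0 -> x = 0,
    forall y, A y -> exists2 x, A x & beta x = y &
    forall x, A x -> S x <-> S' (beta x)].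
Proof.
move=> sA finA sB BA sC CA SB S'C S0 S'0 iS iS' phiC phi_inj phi_surj phi_arc.
have [H HA] := subgroup_zmodClosed sA; pose K := subgroup_type H.
have finH : finite_set [set x | x \in H].
  by apply: sub_finite_set finA => x /HA.
have finK := subgroup_type_finite finH.
have valA (x : K) : A (val x) by apply/HA; exact: valP.
have insubA x : A x -> val (insubd (0 : K) x) = x.
  by move=> /HA; exact: subgroup_insubdK.
pose pre (D : set G) : set K := val @^-1` D.
have preE (D : set G) (x : K) : pre D x = D (val x) by [].
have preim_subgroup (D : set G) : subgroup D -> subgroup (pre D).
  move=> [D0 DB]; split; first by rewrite !preE subgroup_val0.
  by move=> x y Dx Dy; rewrite !preE subgroup_valB; exact: DB.
have preim_inv (D : set G) : inv_closed D -> inv_closed (pre D).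
  move=> /inv_closedP iD; apply/inv_closedP => x /iD.
  by rewrite !preE raddfN.
have iso : digraph_iso (Cay (pre S)) (Cay (pre S')).
  apply: (Cay_iso_finite (phi := fun x : K => insubd (0 : K) (phi (val x)))
            finK (preim_subgroup _ sB) (preim_subgroup _ sC)).
  - by move=> x /SB.
  - by move=> x /S'C.
  - by move=> x Bx; rewrite !preE insubA; [exact: phiC|exact/CA/phiC].
  - move=> x y Bx By /(congr1 val); rewrite !insubA; try exact/CA/phiC.
    by move=> /phi_inj exy; apply: val_inj; exact: exy.
  - move=> y /phi_surj[x Bx exy]; exists (insubd 0 x).
      by rewrite !preE insubA//; exact: BA.
    by rewrite insubA ?exy ?valKd//; exact: BA.
  - move=> x y Bx By; rewrite !preE !subgroup_valB !insubA; try exact/CA/phiC.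
    exact: phi_arc.
have [||uT|uT'||alpha [alpha_bij alphaS]] := ciG finH _ _ _ _ _ iso.
- by rewrite !preE subgroup_val0.
- by rewrite !preE subgroup_val0.
- exact/preim_inv/iS.
- exact/preim_inv/iS'.
- exact: sub_finite_set finK.
exists (fun x => val (alpha (insubd 0 x))); split.
- by move=> x _; exact: valA.
- move=> x y Ax Ay; rewrite -subgroup_valB -raddfB; congr (val (alpha _)).
  by apply: val_inj; rewrite subgroup_valB !insubA//; exact: subgroupB.
- move=> x Ax; rewrite -(subgroup_val0 H) => /val_inj alpha0.
  have /(bij_inj alpha_bij)/(congr1 val) : alpha (insubd 0 x) = alpha 0.
    by rewrite alpha0 raddf0.
  by rewrite insubA.
- move=> y Ay; have [alpha' alphaK alpha'K] := alpha_bij.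
  exists (val (alpha' (insubd 0 y))); first exact: valA.
  by rewrite valKd alpha'K insubA.
- move=> x Ax; rewrite -[S' _]/(pre S' (alpha (insubd 0 x))) -alphaS.
  split=> [Sx|[y Sy] /(bij_inj alpha_bij) yx].
    by exists (insubd 0 x) => //; rewrite !preE insubA.
  by rewrite -(insubA _ Ax) -yx.
Qed.

Lemma same_order_mulrn_eq (a b : G) :
  (forall n, a *+ n = 0 -> b *+ n = 0) ->
  forall m n, a *+ m = a *+ n -> b *+ m = b *+ n.
Proof.
move=> ab m n; wlog le_mn : m n / (m <= n)%N => [wlog_mn|] eq_a.
  by have [/wlog_mn|/ltnW/wlog_mn] := leqP m n; [apply | move=> /(_ (esym eq_a))].
have /ab : a *+ (n - m) = 0 by rewrite mulrnBr// eq_a subrr.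
by rewrite mulrnBr// => /subr0_eq.
Qed.

(** In a finite subgroup containing x and b, some automorphism sends {a, -a} onto
    {b, -b}; the image of x, up to sign, is the root looked for. *)
Lemma same_order_divisible (a b x : G) p :
  (forall n, a *+ n = 0 <-> b *+ n = 0) -> x *+ p = a -> exists y, y *+ p = b.
Proof.
move=> ab xp; have [a0|a_neq0] := pselect (a = 0).
  by exists 0; rewrite mul0rn; apply/esym; exact/(ab 1).
have b_neq0 : b <> 0 by move/(ab 1).
have toB m n : a *+ m = a *+ n <-> b *+ m = b *+ n.
  by split; apply: same_order_mulrn_eq => k; rewrite ab.
have [A [sA finA xbA]] := torsion_finite_subgroup Gtors (finite_set2 x b).
have Ax : A x by apply: xbA; left.
have Ab : A b by apply: xbA; right.
have Aa : A a by rewrite -xp; exact: subgroupMn.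
pose cyc (c : G) := adjoin [set 0] c.
have cyc_subgroup c : subgroup (cyc c).
  have [N [N_gt0 cN]] := Gtors c; apply: adjoin_subgroup cN => //.
  by split=> // y z -> ->; rewrite subr0.
have cycP c n : cyc c (c *+ n) by exists 0 => //; exists n; rewrite add0r.
have cycE c y : cyc c y -> exists n, y = c *+ n.
  by move=> [_ -> [n ->]]; exists n; rewrite add0r.
have cycA c : A c -> cyc c `<=` A.
  by move=> Ac y /cycE[n ->]; exact: subgroupMn.
pose pm (c : G) : set G := [set c; - c].
have pm_cyc c : pm c `<=` cyc c.
  move=> y [->|->]; first exact: (cycP c 1).
  by apply: subgroupN; [exact: cyc_subgroup | exact: (cycP c 1)].
have pm0 c : c <> 0 -> ~ pm c 0.
  by move=> c0 [/esym//|/esym/eqP]; rewrite oppr_eq0 => /eqP.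
have pm_inv c : inv_closed (pm c).
  by apply/inv_closedP => y [->|->]; [right | left; rewrite opprK].
have pm_arc c m n : pm c (c *+ n - c *+ m) <->
    c *+ n = c *+ m.+1 \/ c *+ m = c *+ n.+1.
  rewrite !mulrS; split=> [[e|e]|[e|e]].
  - by left; move/eqP: e; rewrite subr_eq => /eqP.
  - by right; rewrite -(subrK (c *+ m) (c *+ n)) e addrA subrr add0r.
  - by left; rewrite e addrK.
  - by right; rewrite e opprD addrCA subrr addr0.
pose phi y := b *+ xget 0%N [set n | y = a *+ n].
have phiE n : phi (a *+ n) = b *+ n.
  by apply/toB; rewrite -(@xgetI _ 0%N [set k | a *+ n = a *+ k] n).
(* a |-> b induces an isomorphism of the two cycles (or edges) *)
have [||||beta [_ betaB _ _ betaS]] :=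
  fusion sA finA (cyc_subgroup a) (cycA a Aa) (cyc_subgroup b) (cycA b Ab)
    (pm_cyc a) (pm_cyc b) (pm0 a a_neq0) (pm0 b b_neq0)
    (fun=> pm_inv a) (fun=> pm_inv b) (phi := phi).
- by move=> y /cycE[n ->]; rewrite phiE.
- by move=> y z /cycE[m ->] /cycE[n ->]; rewrite !phiE => /toB.
- by move=> y /cycE[n ->]; exists (a *+ n); rewrite ?phiE.
- by move=> y z /cycE[m ->] /cycE[n ->]; rewrite !phiE !pm_arc !toB.
have beta0 : beta 0 = 0.
  by rewrite -(subrr 0) betaB ?subrr//; exact: subgroup0.
have betaMn n : beta (x *+ n) = beta x *+ n.
  elim: n => [|n IHn]; first by rewrite !mulr0n.
  have AxN : A (- (x *+ n)) by apply: (subgroupN sA); exact: subgroupMn.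
  rewrite !mulrS -[x *+ n in LHS]opprK betaB// -[- (x *+ n)]sub0r betaB//.
  + by rewrite beta0 sub0r opprK IHn.
  + exact: subgroup0.
  + exact: subgroupMn.
have [] : pm b (beta a) by apply/(betaS a Aa); left.
  by move=> eb; exists (beta x); rewrite -betaMn xp.
by move=> eb; exists (- beta x); rewrite mulNrn -betaMn xp eb opprK.
Qed.

Lemma extend_prime P x p : prime p -> partial_aut P -> dom P (x *+ p) ->
  exists P', [/\ partial_aut P', P `<=` P' & dom P' x].
Proof.
move=> p_prime pP [b Pab]; have [sP finP Pfun Pinj] := pP.
have [Px|nPx] := pselect (dom P x); first by exists P; split.
have [y yb nPy] : exists2 y, y *+ p = b & ~ dom (converse P) y.
  have [[a' [b' [Pa'b' a'p]]]|noa'] :=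
    pselect (exists a' b', P (a', b') /\ a' *+ p = x *+ p).
    have [||y0 [y0p nPy0]] := @torsion_outside_range G P (x - a') p pP.
    - by rewrite mulrnBl a'p subrr.
    - move=> Dxa'; apply: nPx; rewrite -(subrK a' x).
      by apply: (subgroupD (dom_subgroup sP)) => //; exists b'.
    exists (y0 + b').
      rewrite mulrnDl y0p add0r; apply: (partial_aut_fun pP _ Pab).
      by rewrite -a'p; exact: partial_autMn.
    rewrite (subgroupDr (dom_subgroup _))//; last by exists a'.
    by have [] := converse_partial_aut pP.
  (* every p-th root of b lies outside the range, as its preimage would be a
     p-th root of x *+ p in the domain *)
  have [||y yb] := @same_order_divisible (x *+ p) b x p.
  - move=> n; split=> n0.
      by apply: Pfun; rewrite -n0; exact: partial_autMn.
    by apply: Pinj; rewrite -n0; exact: partial_autMn.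
  - by [].
  exists y => // -[x' Px'y]; apply: noa'; exists x', y; split=> //.
  by apply: (partial_aut_inj pP _ Pab); rewrite -yb; exact: partial_autMn.
have [m [m_gt0 xm]] := Gtors x; have [n [n_gt0 yn]] := Gtors y.
have mn_gt0 : (0 < m * n)%N by rewrite muln_gt0 m_gt0.
have xy_mn : (x, y) *+ (m * n) = 0.
  by rewrite pair_mulrn mulrnA xm mul0rn mulnC mulrnA yn mul0rn.
have Pp : P (x *+ p, y *+ p) by rewrite yb.
exists (adjoin P (x, y)); split.
- split.
  + exact: adjoin_subgroup xy_mn.
  + exact: adjoin_finite xy_mn finP.
  + exact: adjoin_functional Pp nPx.
  + have [csP _ cPfun _] := converse_partial_aut pP.
    move=> z [[a c] Pac [k e]].
    apply: (adjoin_functional csP cPfun p_prime (x := y) (y := x)) => //.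
    exists (c, a) => //; exists k; move: e.
    by rewrite !pair_mulrn => -[-> ->].
- exact: sub_adjoin.
- by exists y; exact: mem_adjoin.
Qed.

(** Induction on a positive N with N x in the domain: for p prime dividing N,
    first add (N / p) x, whose p-th multiple is already there. *)
Lemma extend_dom P x : partial_aut P ->
  exists P', [/\ partial_aut P', P `<=` P' & dom P' x].
Proof.
move=> pP; have [N [N_gt0 xN]] := Gtors x.
have : dom P (x *+ N).
  by rewrite xN; have [sP _ _ _] := pP; exact: subgroup0 (dom_subgroup sP).
elim/ltn_ind: N P pP N_gt0 {xN} => N IHN P pP N_gt0 PN.
have [N_gt1|] := ltnP 1 N; last first.
  by move=> N_le1; exists P; split=> //; move: N N_gt0 N_le1 PN {IHN} => [|[]].
have p_prime := pdiv_prime N_gt1; have := pdiv_dvd N.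
set p := pdiv N in p_prime *; move=> /dvdnP[n Nnp].
have n_gt0 : (0 < n)%N by case: n Nnp N_gt0 => // ->.
have [|P1 [pP1 PP1 P1n]] := @extend_prime P (x *+ n) p p_prime pP.
  by rewrite -mulrnA -Nnp.
have [|P2 [pP2 P12 P2x]] := IHN n _ P1 pP1 n_gt0 P1n.
  by rewrite Nnp ltn_Pmulr// prime_gt1.
by exists P2; split=> // z /PP1/P12.
Qed.

Lemma extend_both P x : partial_aut P -> exists P',
  [/\ partial_aut P', P `<=` P', dom P' x & dom (converse P') x].
Proof.
move=> /(extend_dom x)[P1 [pP1 PP1 [y P1xy]]].
have [P2 [pP2 P12 P2x]] := extend_dom x (converse_partial_aut pP1).
exists (converse P2); split.
- exact: converse_partial_aut.
- by move=> [v w] /PP1 P1vw; exact: P12.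
- by exists y; exact: P12.
- by case: P2x => z P2xz; exists z.
Qed.

(** Back and forth along an enumeration of G; the union of the resulting chain is
    the graph of an automorphism. *)
Lemma extend_to_aut P : countable [set: G] -> partial_aut P ->
  exists2 alpha : {additive G -> G}, bijective alpha &
    forall x y, P (x, y) -> alpha x = y.
Proof.
move=> /countable_injP[code code_inj] pP.
have /choice[ext extP] (Qx : set (G * G) * G) : exists Q', partial_aut Qx.1 ->
    [/\ partial_aut Q', Qx.1 `<=` Q', dom Q' Qx.2 & dom (converse Q') Qx.2].
  have [pQ|] := pselect (partial_aut Qx.1); last by exists set0.
  by have [Q' ?] := extend_both Qx.2 pQ; exists Q'.
pose decode n := xget 0 [set x | code x = n].
have decodeK x : decode (code x) = x.
  apply: xget_unique => //= y /code_inj; apply; exact: in_setT.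
pose chain := fix chain n := if n is m.+1 then ext (chain m, decode m) else P.
have chain_aut n : partial_aut (chain n).
  by elim: n => [//|n IHn]; have [] := extP (chain n, decode n) IHn.
have chain_mono m n z : (m <= n)%N -> chain m z -> chain n z.
  move=> /subnK <-; elim: (n - m)%N => [//|k IHk] /IHk.
  by have [_ + _ _] := extP (chain (k + m), decode (k + m)) (chain_aut _); exact.
have chain_dom x : dom (chain (code x).+1) x /\
    dom (converse (chain (code x).+1)) x.
  have [_ _] := extP (chain (code x), decode (code x)) (chain_aut _).
  by rewrite /= decodeK.
pose Q : set (G * G) := [set z | exists n, chain n z].
have Q2 z w : Q z -> Q w -> exists n, chain n z /\ chain n w.
  move=> [m Qz] [n Qw]; exists (maxn m n).
  by split; [apply: chain_mono Qz | apply: chain_mono Qw];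
    rewrite ?leq_maxl ?leq_maxr.
have Qfun x y y' : Q (x, y) -> Q (x, y') -> y = y'.
  by move=> Qy /(Q2 _ _ Qy)[n [+ +]]; exact: partial_aut_fun (chain_aut n).
have Qinj x x' y : Q (x, y) -> Q (x', y) -> x = x'.
  by move=> Qx /(Q2 _ _ Qx)[n [+ +]]; exact: partial_aut_inj (chain_aut n).
have QB z w : Q z -> Q w -> Q (z - w).
  move=> Qz /(Q2 _ _ Qz)[n [nz nw]]; exists n.
  by have [sn _ _ _] := chain_aut n; exact: subgroupB.
have /choice[alpha alphaQ] x : exists y, Q (x, y).
  by have [[y xy] _] := chain_dom x; exists y, (code x).+1.
have /choice[alpha' alpha'Q] y : exists x, Q (x, y).
  by have [_ [x xy]] := chain_dom y; exists x, (code y).+1.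
have alphaB : GRing.zmod_morphism alpha.
  by move=> x y; apply: (Qfun (x - y)) => //; exact: QB (alphaQ x) (alphaQ y).
pose m := GRing.isZmodMorphism.Build G G alpha alphaB.
pose a : {additive G -> G} := HB.pack alpha m.
exists a; last by move=> x y Pxy; apply: (Qfun x) => //; exists 0%N.
exists alpha' => x; first by apply: Qinj (alphaQ x); exact: alpha'Q.
by apply: Qfun (alpha'Q x); exact: alphaQ.
Qed.

Lemma CI_class_of_finite_subgroups : countable [set: G] -> CI_class u G.
Proof.
move=> Gcount S S' S0 S'0 iS iS' finS [f0 [f0_bij f0E]].
pose f x := f0 x - f0 0.
have fE x y : Cay S x y <-> Cay S' (f x) (f y).
  by rewrite f0E !CayE /f opprB addrA subrK.
have f_0 : f 0 = 0 by rewrite /f subrr.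
have [g0 f0K g0K] := f0_bij; pose g y := g0 (y + f0 0).
have fK : cancel f g by move=> x; rewrite /g /f subrK f0K.
have gK : cancel g f by move=> y; rewrite /g /f g0K addrK.
have fS s : S s <-> S' (f s).
  by have := fE 0 s; rewrite !CayE f_0 !subr0.
have finS' : finite_set S'.
  apply: (sub_finite_set _ (finite_image f finS)) => s' S's'.
  by exists (g s'); [rewrite /= fS gK | exact: gK].
have finU : finite_set (S `|` S') by rewrite finite_setU.
have [A [sA finA subA]] := torsion_finite_subgroup Gtors finU.
have SA : S `<=` A by move=> s Ss; apply: subA; left.
have S'A : S' `<=` A by move=> s Ss; apply: subA; right.
have [||||||beta [betaA betaB beta0 beta_surj betaS]] :=
  @fusion A (span S) (span S') S S' f sA finA (span_subgroup S) _
    (span_subgroup S') _ (@sub_span G S) (@sub_span G S') S0 S'0 iS iS'.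
- by move=> x; apply.
- by move=> x; apply.
- by apply: arc_map_span => // x y /fE.
- by move=> x y _ _ /(can_inj fK).
- move=> y Sy; exists (g y); last exact: gK.
  apply: (@arc_map_span G S' S) Sy; first by rewrite -f_0 fK.
  by move=> v w; rewrite fE !gK.
- by move=> x y _ _; have := fE x y; rewrite !CayE.
pose P : set (G * G) := [set z | A z.1 /\ z.2 = beta z.1].
have beta00 : beta 0 = 0.
  by rewrite -(subrr 0) betaB ?subrr//; exact: subgroup0.
have pP : partial_aut P.
  split.
  - split; first by split; [exact: subgroup0 | rewrite /= beta00].
    move=> [x1 x2] [y1 y2] [/= Ax ->] [/= Ay ->].
    by split=> /=; [exact: subgroupB | rewrite betaB].
  - apply: (sub_finite_set _ (finite_image (fun x => (x, beta x)) finA)).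
    by move=> [x1 x2] [/= Ax ->]; exists x1.
  - by move=> y [_ /= ->].
  - by move=> x [/= Ax /esym]; exact: beta0.
have [alpha alpha_bij alphaP] := extend_to_aut Gcount pP.
have alphaE x : A x -> alpha x = beta x by move=> Ax; exact: alphaP.
exists alpha; split=> //; apply/seteqP; split=> [_ [s Ss <-]|s' S's'].
  by rewrite alphaE; [apply/betaS => //; exact: SA | exact: SA].
have [s As sE] := beta_surj s' (S'A _ S's').
by exists s; rewrite ?alphaE//; apply/betaS; rewrite ?sE.
Qed.

End CIonSubgroups.

Theorem theorem3p4 (G : zmodType) (Gcountable : countable [set: G])
    (Gtorsion : torsion_group G) :
  (strongly_DCIf_group G <->
     forall H : zmodClosed G, finite_set [set x : G | x \in H] ->
       DCI_group (subgroup_type H)) /\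
  (strongly_CIf_group G <->
     forall H : zmodClosed G, finite_set [set x : G | x \in H] ->
       CI_group (subgroup_type H)).
Proof.
split.
  rewrite strongly_DCIfE; split=> ciG => [H finH|].
    apply/DCI_finiteE; first exact: subgroup_type_finite.
    exact: CI_class_subgroup.
  apply: CI_class_of_finite_subgroups => // H finH.
  apply/DCI_finiteE; last exact: ciG.
  exact: subgroup_type_finite.
rewrite strongly_CIfE; split=> ciG => [H finH|].
  apply/CI_finiteE; first exact: subgroup_type_finite.
  exact: CI_class_subgroup.
apply: CI_class_of_finite_subgroups => // H finH.
apply/CI_finiteE; last exact: ciG.
exact: subgroup_type_finite.
Qed.
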